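(* For every $(x,y,t),(x_0,y_0,t_0)\in\mathbb{R}^+\times\mathbb{R}^2$ with $t_0<t$ and $y_0>y$, and for every $r>0$, we have $$\Psi(x,y,t;x_0,y_0,t_0)=\Psi\Big(\tfrac{x}{x_0},\tfrac{y-y_0}{x_0},t-t_0\Big),$$ $$\Psi(x,y,t;x_0,y_0,t_0)=\tfrac1r\,\Psi\Big(x,\tfrac yr,\tfrac tr;\,x_0,\tfrac{y_0}{r},\tfrac{t_0}{r}\Big).$$ In particular, $$\Psi(x,y,t;x_0,y_0,t_0)=\Psi(rx,ry,t;rx_0,ry_0,t_0)$$ and $$\Psi(x,y,t;x_0,y_0,t_0)=\tfrac{1}{t-t_0}\,\Psi\Big(\tfrac{x}{x_0},\tfrac{y-y_0}{(t-t_0)x_0},1\Big).$$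
   Context: $\mathbb{R}^+=\,]0,+\infty[$. For $(x,y,t),(x_0,y_0,t_0)\in\mathbb{R}^+\times\mathbb{R}^2$ with $t>t_0$ and $y<y_0$, $\Psi(x,y,t;x_0,y_0,t_0)$ is the infimum of $\int_0^{t-t_0}\omega(s)^2\,ds$ over all $\omega\in L^1([0,t-t_0])$ for which the absolutely continuous solution of $\dot q_1(s)=\omega(s)q_1(s)$, $\dot q_2(s)=q_1(s)$, $q_1(0)=x$, $q_2(0)=y$, satisfies $q_1(t-t_0)=x_0$, $q_2(t-t_0)=y_0$. With three arguments, $\Psi(x,y,t):=\Psi(x,y,t;1,0,0)$. *)

(* Defs.v *)
From HB Require Import structures.
From mathcomp Require Import all_boot all_order all_algebra.
From mathcomp Require Import all_classical all_reals all_analysis.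

Set Implicit Arguments.
Unset Strict Implicit.
Unset Printing Implicit Defensive.

Import Order.TTheory GRing.Theory Num.Theory.
Import numFieldNormedType.Exports.

Local Open Scope classical_set_scope.
Local Open Scope ring_scope.

(* The intervals `[u i, v i] may share endpoints or be degenerate; only their
   interiors are required to be pairwise disjoint. *)
Definition absolutely_continuous (R : realType) (a b : R) (f : R -> R) : Prop :=
  forall e : R, 0 < e -> exists2 d : R, 0 < d &
    forall (n : nat) (u v : 'I_n -> R),
      (forall i, [/\ a <= u i, u i <= v i & v i <= b]) ->
      trivIset [set: 'I_n] (fun i => `]u i, v i[%classic) ->
      \sum_(i < n) (v i - u i) < d ->
      \sum_(i < n) `|f (v i) - f (u i)| < e.

(* Caratheodory solutions on `[0, T]: the equations hold at almost every time.
   The functions are total on R, but only their values on `[0, T] matter: the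
   derivatives are taken at interior points. *)
Definition is_trajectory (R : realType) (T x y : R) (w q1 q2 : R -> R) : Prop :=
  [/\ absolutely_continuous 0 T q1,
      absolutely_continuous 0 T q2,
      {ae @lebesgue_measure R, forall s, s \in `]0, T[%R ->
        is_derive s (1 : R) q1 (w s * q1 s) /\ is_derive s (1 : R) q2 (q1 s)},
      q1 0 = x &
      q2 0 = y].

(* Elements of L^1 are given by Borel representatives; changing w on a null set
   affects neither its trajectories nor its cost.  The trajectory issued from
   (x, y) is unique on `[0, T], so "exists" and "forall" agree below. *)
Definition admissible (R : realType) (T x y x0 y0 : R) (w : R -> R) : Prop :=
  (@lebesgue_measure R).-integrable `[0, T] (EFin \o w) /\
  exists q1 q2 : R -> R,
    [/\ is_trajectory T x y w q1 q2, q1 T = x0 & q2 T = y0].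

Definition cost (R : realType) (T : R) (w : R -> R) : \bar R :=
  (\int[@lebesgue_measure R]_(s in `[0%R, T]) ((w s) ^+ 2)%:E)%E.

(* The infimum is taken in \bar R because the cost of an L^1 control that is
   not square integrable is +oo. *)
Definition Psi (R : realType) (x y t x0 y0 t0 : R) : \bar R :=
  ereal_inf [set cost (t - t0) w |
             w in [set w | admissible (t - t0) x y x0 y0 w]].

Definition Psi3 (R : realType) (x y t : R) : \bar R := Psi x y t 1 0 0.

(* Main.v *)
Require Import Defs.
From mathcomp Require Import all_boot all_order all_algebra.
From mathcomp Require Import all_classical all_reals all_analysis.
From mathcomp Require Import measurable_realfun ring.
Import Order.TTheory GRing.Theory Num.Theory.
Import numFieldNormedType.Exports.
Local Open Scope ring_scope.

(* For c, r > 0, the map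
     (q1, q2, w) |-> (c * q1(r s), (c / r) * q2(r s) + b, r * w(r s))
   sends trajectories on [0, T] to trajectories on [0, T / r] and multiplies
   the cost by r; its inverse is a map of the same kind.  Each identity is the
   resulting equality of infima for suitable c, r and b. *)

(** * Change of variables under the dilation [s |-> r * s] *)

Section Dilation.
Set Implicit Arguments.
Unset Strict Implicit.
Local Open Scope classical_set_scope.
Context (R : realType) (r : R).
Hypothesis r0 : 0 < r.
Implicit Types (D : set R).
Local Notation mu := (@lebesgue_measure R).
Local Notation dil := ( *%R r : measurableTypeR R -> measurableTypeR R).

Lemma preimage_dilation_itv (b1 b2 : bool) (u v : R) :
  *%R r @^-1` [set` Interval (BSide b1 u) (BSide b2 v)] =
  [set` Interval (BSide b1 (u / r)) (BSide b2 (v / r))].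
Proof.
apply/seteqP; split=> s; case: b1; case: b2 => /=;
  by rewrite !in_itv /= ?ler_pdivrMr ?ltr_pdivrMr ?ler_pdivlMr ?ltr_pdivlMr//
     mulrC.
Qed.

Lemma measurable_dilation : measurable_fun setT dil.
Proof. by []. Qed.

(** By uniqueness of Lebesgue measure, it is enough to compare both sides on half-open intervals,
    where dividing the endpoints by [r] divides the length by [r]. *)
Lemma lebesgue_measure_dilation D : measurable D ->
  pushforward (mscale (NngNum (ltW r0)) mu) dil D = mu D.
Proof.
move=> mD; apply/esym/lebesgue_measure_unique => //= _ [[a b]] _ <-.
rewrite /pushforward /mscale /= preimage_dilation_itv !lebesgue_measure_itv/=.
rewrite !lte_fin ltr_pM2r ?invr_gt0//; case: ifPn => _; last by rewrite mule0.
by rewrite -!EFinB -mulrBl -EFinM mulrC divfK// gt_eqF.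
Qed.

(** Follows by replacing [mu] with [r] times its pushforward under the dilation. Nonnegativity of
    [f] allows infinite integrals, as needed for costs. *)
Lemma ge0_integral_dilation D (f : R -> \bar R) :
  measurable D -> measurable_fun D f -> (forall s, D s -> 0 <= f s)%E ->
  (\int[mu]_(s in D) f s = r%:E * \int[mu]_(s in dil @^-1` D) f (r * s)%R)%E.
Proof.
move=> mD mf f0.
have mdD : measurable (dil @^-1` D).
  by rewrite -[X in measurable X]setTI; exact: measurable_dilation.
have mfd : measurable_fun (dil @^-1` D) (f \o dil).
  by apply: (measurable_comp mD) => // _ [s Ds <-].
rewrite -[RHS](ge0_integral_mscale mu mdD (NngNum (ltW r0)) mfd); last first.
  by move=> s; exact: f0.
rewrite -(ge0_integral_pushforward measurable_dilation)//.
  by apply: eq_measure_integral => A mA _; exact/esym/lebesgue_measure_dilation.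
by move=> s /set_mem; exact: f0.
Qed.

Lemma negligible_dilation D :
  mu.-negligible D -> mu.-negligible (dil @^-1` D).
Proof.
move=> [A [mA A0 DA]]; exists (dil @^-1` A); split; last first.
- by move=> s /DA.
- apply/eqP; move/eqP: (lebesgue_measure_dilation mA).
  by rewrite A0 /pushforward /mscale /= mule_eq0 eqe gt_eqF.
- by rewrite -[X in measurable X]setTI; exact: measurable_dilation.
Qed.

End Dilation.

(** * Action of the rescaling on trajectories, controls and costs *)

Section Rescaling.
Set Implicit Arguments.
Unset Strict Implicit.
Local Open Scope classical_set_scope.
Context (R : realType) (r : R).
Hypothesis r0 : 0 < r.
Local Notation mu := (@lebesgue_measure R).

(** The tolerance [e / k] for [f] gives some [d], and [d / r] serves the rescaled function; the
    shift [b] cancels in differences. *)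
Lemma absolutely_continuous_rescale (a T k b : R) (f : R -> R) : 0 < k ->
  absolutely_continuous a T f ->
  absolutely_continuous (a / r) (T / r) (fun s => k * f (r * s) + b).
Proof.
move=> k0 acf e e0.
have [d d0 Hd] := acf (e / k) (divr_gt0 e0 k0).
exists (d / r); first exact: divr_gt0.
move=> n u v uv disj lt_d.
have : \sum_(i < n) `|f (r * v i) - f (r * u i)| < e / k.
  apply: Hd.
  - move=> i; have [au uvi vT] := uv i.
    by rewrite ler_pM2l// mulrC -ler_pdivrMr// au mulrC -ler_pdivlMr.
  (* The dilated open intervals are the preimages of the given ones under [s |-> s / r], so they
     stay disjoint. *)
  - apply/trivIsetP => i j _ _ ij.
    move/trivIsetP : disj => /(_ i j Logic.I Logic.I ij).
    move=> /(congr1 (preimage (fun s => s / r))).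
    rewrite preimage_setI preimage_set0 => <-; congr (_ `&` _); apply/seteqP;
      by split => s; rewrite /= !in_itv/= ltr_pdivlMr// ltr_pdivrMr//
        ![_ * r]mulrC.
  - by under eq_bigr do rewrite -mulrBr; rewrite -mulr_sumr mulrC -ltr_pdivlMr.
rewrite ltr_pdivlMr// mulr_suml; congr (_ < _); apply: eq_bigr => i _.
rewrite opprD addrACA subrr addr0 -mulrBr normrM mulrC.
by rewrite (gtr0_norm k0).
Qed.

Lemma is_trajectory_rescale (T x y c b : R) (w q1 q2 : R -> R) : 0 < c ->
  is_trajectory T x y w q1 q2 ->
  is_trajectory (T / r) (c * x) (c / r * y + b) (fun s => r * w (r * s))
    (fun s => c * q1 (r * s)) (fun s => c / r * q2 (r * s) + b).
Proof.
move=> c0 [ac1 ac2 sol q10 q20].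
have cr0 : 0 < c / r by exact: divr_gt0.
have q1E : (fun s => c * q1 (r * s)) = (fun s => c * q1 (r * s) + 0).
  by apply/funext => s; rewrite addr0.
split; rewrite ?mulr0 ?q10 ?q20//.
- by rewrite q1E -(mul0r r^-1); exact: absolutely_continuous_rescale.
- by rewrite -(mul0r r^-1); exact: absolutely_continuous_rescale.
(* The equations can fail at [s] only if they failed at [r * s]. Elsewhere the chain rule gives a
   factor [r], absorbed by the control for [q1] and cancelled by [c / r] for [q2]. *)
apply: negligibleS (negligible_dilation r0 sol) => s /= H sol_rs; apply: H.
rewrite in_itv/= => /andP[s0 sT].
have [|d1 d2] := sol_rs.
  by rewrite in_itv/= mulr_gt0//= mulrC -ltr_pdivlMr.
split; apply: is_derive_eq; rewrite /GRing.scale /=; first by ring.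
by field; rewrite gt_eqF.
Qed.

Lemma preimage_dilation_cc0 (T : R) : *%R r @^-1` `[0, T] = `[0, T / r].
Proof. by rewrite preimage_dilation_itv// mul0r. Qed.

Lemma integrable_rescale (T : R) (w : R -> R) :
  mu.-integrable `[0, T] (EFin \o w) ->
  mu.-integrable `[0, T / r] (EFin \o (fun s => r * w (r * s))).
Proof.
move=> /integrableP[mw wT].
have mwr : measurable_fun `[0, T / r] (fun s => (w (r * s))%:E).
  rewrite -preimage_dilation_cc0.
  by apply: (measurable_comp (measurable_itv _) _ mw) => // _ [s sT <-].
apply: (@integrableZl _ _ _ mu _ _ _ (EFin \o (w \o *%R r))) => //.
apply/integrableP; split=> //.
have mabs : measurable_fun `[0, T] (fun s => `|(EFin \o w) s|%E).
  exact: measurableT_comp.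
move: wT; rewrite (ge0_integral_dilation r0 (measurable_itv _) mabs)//.
rewrite preimage_dilation_cc0.
(* Multiplying by [r > 0] preserves and reflects finiteness, since [r * +oo = +oo]. *)
move=> rI; rewrite -(@lte_pmul2l _ r%:E) ?lte_fin//.
by rewrite gt0_muley ?lte_fin.
Qed.

(** Squaring the control gives [r ^+ 2], and the change of variables gives [r^-1]. *)
Lemma cost_rescale (T : R) (w : R -> R) :
  measurable_fun `[0, T] w ->
  cost (T / r) (fun s => r * w (r * s)) = (r%:E * cost T w)%E.
Proof.
move=> mw.
have rVK : ((r^-1)%:E * r%:E = 1 :> \bar R)%E by rewrite -EFinM mulVf// gt_eqF.
have mw2 : measurable_fun `[0, T] (fun s => (w s ^+ 2)%:E).
  exact/measurable_EFinP/measurable_funX.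
have mrw2 : measurable_fun `[0, T] (fun s => ((r * w s) ^+ 2)%:E).
  exact/measurable_EFinP/measurable_funX/measurable_funM.
have := ge0_integral_dilation r0 (measurable_itv _) mrw2.
under eq_integral do rewrite exprMn EFinM.
rewrite ge0_integralZl//; last 2 first.
  by move=> s _; rewrite lee_fin sqr_ge0.
  by rewrite lee_fin sqr_ge0.
rewrite preimage_dilation_cc0 => E.
rewrite -[LHS]mul1e -rVK -muleA -[X in (_ * X)%E]E; last first.
  by move=> s _; rewrite lee_fin sqr_ge0.
by rewrite muleA -EFinM expr2 mulKf// gt_eqF.
Qed.

Lemma admissible_rescale (T x y x0 y0 c b : R) (w : R -> R) : 0 < c ->
  admissible T x y x0 y0 w ->
  admissible (T / r) (c * x) (c / r * y + b) (c * x0) (c / r * y0 + b)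
    (fun s => r * w (r * s)).
Proof.
move=> c0 [iw [q1 [q2 [traj q1T q2T]]]]; split; first exact: integrable_rescale.
have rT : r * (T / r) = T by rewrite mulrC divfK// gt_eqF.
exists (fun s => c * q1 (r * s)), (fun s => c / r * q2 (r * s) + b).
by split; [exact: is_trajectory_rescale|rewrite rT q1T|rewrite rT q2T].
Qed.

Lemma le_Psi_rescale (x y t x0 y0 t0 c b : R) : 0 < c ->
  (Psi (c * x) (c / r * y + b) (t / r) (c * x0) (c / r * y0 + b) (t0 / r) <=
   r%:E * Psi x y t x0 y0 t0)%E.
Proof.
(* The factor [r] moves inside the infimum, so each admissible control needs only a rescaled
   competitor of cost [r] times its own. *)
move=> c0; rewrite /Psi -ereal_inf_pZl// -mulrBl.
apply: le_ereal_inf => _ [_ [w adm <-] <-].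
exists (fun s => r * w (r * s)); first exact: admissible_rescale.
by rewrite cost_rescale//; case: adm => /integrableP[/measurable_EFinP].
Qed.

End Rescaling.

(** One inequality is [le_Psi_rescale]; the other is the same lemma for the inverse map. *)
Lemma Psi_rescale (R : realType) (x y t x0 y0 t0 c r b : R) : 0 < c -> 0 < r ->
  Psi x y t x0 y0 t0 =
  (r^-1%:E * Psi (c * x) (c / r * y + b) (t / r)
                 (c * x0) (c / r * y0 + b) (t0 / r))%E.
Proof.
move=> c0 r0.
have c_neq0 : c != 0 by rewrite gt_eqF.
have r_neq0 : r != 0 by rewrite gt_eqF.
have rVK : (r^-1%:E * r%:E = 1 :> \bar R)%E by rewrite -EFinM mulVf.
have rV0 : 0 < r^-1 by rewrite invr_gt0.
have cV0 : 0 < c^-1 by rewrite invr_gt0.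
apply/eqP; rewrite eq_le; apply/andP; split; last first.
  rewrite -[leRHS]mul1e -rVK -muleA lee_pmul2l//.
  exact: le_Psi_rescale.
(* The inverse of [z |-> c / r * z + b] has slope [r / c] and shift [- (c^-1 * r * b)]. *)
have := le_Psi_rescale rV0 (c * x) (c / r * y + b) (t / r) (c * x0)
  (c / r * y0 + b) (t0 / r) (- (c^-1 * r * b)) cV0.
have yE z : c^-1 / r^-1 * (c / r * z + b) + - (c^-1 * r * b) = z.
  by field; rewrite c_neq0.
by rewrite !mulKf// !yE invrK !divfK.
Qed.

(** Normalizes the initial time to 0, because [Psi_rescale] dilates times without translating
    them. *)
Lemma Psi_sub_time (R : realType) (x y t x0 y0 t0 : R) :
  Psi x y t x0 y0 t0 = Psi x y (t - t0) x0 y0 0.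
Proof. by rewrite /Psi subr0. Qed.

Theorem proposition1p1 (R : realType) (x y t x0 y0 t0 : R)
    (hx : 0 < x) (hx0 : 0 < x0) (ht : t0 < t) (hy : y < y0)
    (r : R) (hr : 0 < r) :
  [/\ Psi x y t x0 y0 t0 = Psi3 (x / x0) ((y - y0) / x0) (t - t0),
      Psi x y t x0 y0 t0 =
        ((r^-1)%:E * Psi x (y / r) (t / r) x0 (y0 / r) (t0 / r))%E,
      Psi x y t x0 y0 t0 = Psi (r * x) (r * y) t (r * x0) (r * y0) t0 &
      Psi x y t x0 y0 t0 =
        (((t - t0)^-1)%:E *
          Psi3 (x / x0) ((y - y0) / ((t - t0) * x0)) 1)%E].
Proof.
have x0_neq0 : x0 != 0 by rewrite gt_eqF.
have T0 : 0 < t - t0 by rewrite subr_gt0.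
have T_neq0 : t - t0 != 0 by rewrite gt_eqF.
have x0V : 0 < x0^-1 by rewrite invr_gt0.
split.
(* Time is not dilated; the scale [x0^-1] and the shift send the target [(x0, y0)] to [(1, 0)]. *)
- rewrite Psi_sub_time (@Psi_rescale _ _ _ _ _ _ _ x0^-1 1 (- (y0 / x0))) //.
  rewrite invr1 mul1e !mulr1 /Psi3 mulVf// mulrBl.
  by rewrite mulrC [x0^-1 * y]mulrC [x0^-1 * y0]mulrC subrr.
- rewrite (@Psi_rescale _ x y t x0 y0 t0 1 r 0)//.
  by rewrite !mul1r !addr0 ![r^-1 * _]mulrC.
- rewrite (@Psi_rescale _ x y t x0 y0 t0 r 1 0)//.
  by rewrite invr1 mul1e !mulr1 !addr0.
- rewrite Psi_sub_time.
  (* Dilating by [t - t0] makes the duration 1; the shift again sends the target to [(1, 0)]. *)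
  rewrite (@Psi_rescale _ _ _ _ _ _ _ x0^-1 (t - t0)
    (- (y0 / ((t - t0) * x0)))) //.
  rewrite /Psi3 mul0r divff// mulVf//; congr (_ * Psi _ _ _ _ _ _)%E.
  + by rewrite mulrC.
  + by field; apply/andP.
  + by field; apply/andP.
Qed.
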